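(* Let $M$ be a non-compact, locally compact metric space and let $\varphi_\lambda : M\times\mathbb{R}\to M$, $\lambda\in[0,1]$, be a (continuous) parametrized family of dissipative flows. For each $\lambda\in[0,1]$ let $K_\lambda$ denote the global attractor of $\varphi_\lambda$. Then the family $(K_\lambda)_{\lambda\in[0,1]}$ is a continuation of $K_0$ if and only if the family $(\varphi_\lambda)_{\lambda\in[0,1]}$ is uniformly dissipative.
   Context: A parametrized family of flows $\varphi_\lambda$, $\lambda\in[0,1]$, is assumed continuous: $(x,t,\lambda)\mapsto\varphi_\lambda(x,t)$ is continuous. For a flow write $xt=\varphi(x,t)$ and $xI=\varphi(\{x\}\times I)$ for $I\subset\mathbb{R}$. The omega-limit of $x$ is $\omega(x)=\bigcap_{t>0}\overline{x[t,\infty)}$; $\omega_\lambda(x)$ denotes the omega-limit with respect to $\varphi_\lambda$. Dissipative: a flow $\varphi:M\times\mathbb{R}\to M$ is dissipative if $\omega(x)\neq\emptyset$ for each $x\in M$ and the closure of $\Omega(\varphi)=\bigcup_{x\in M}\omega(x)$ is compact. Attractors: a compact invariant set $K$ is stable if every neighborhood $U$ of $K$ contains a neighborhood $V$ of $K$ with $V[0,\infty)\subset U$; it is attracting if there is a neighborhood $U$ of $K$ with $\emptyset\neq\omega(x)\subset K$ for every $x\in U$. An attractor is a compact invariant set that is both attracting and stable. Its region of attraction is $\mathcal{A}(K)=\{x\in M:\emptyset\neq\omega(x)\subset K\}$. $K$ is a global attractor if $\mathcal{A}(K)=M$. (A flow is dissipative if and only if it has a global attractor; the global attractor is unique.) Uniformly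 dissipative: the family $(\varphi_\lambda)_{\lambda\in[0,1]}$ is uniformly dissipative if $\omega_\lambda(x)\neq\emptyset$ for all $x\in M$, $\lambda\in[0,1]$, and the closure of $\Omega=\bigcup_{\lambda\in[0,1]}\Omega(\varphi_\lambda)$ is compact. Isolated invariant sets and continuation: a compact invariant set $K$ is isolated if it has an isolating neighborhood, i.e. a compact neighborhood $N$ of $K$ such that $K$ is the maximal invariant set in $N$. Let $J\subset[0,1]$ be a closed non-degenerate subinterval and, for each $\lambda\in J$, let $K_\lambda$ be an isolated invariant set for $\varphi_\lambda$. The family $(K_\lambda)_{\lambda\in J}$ is a continuation if for each $\lambda_0\in J$ and each isolating neighborhood $N_{\lambda_0}$ of $K_{\lambda_0}$ (for $\varphi_{\lambda_0}$) there is $\delta>0$ such that $N_{\lambda_0}$ is an isolating neighborhood of $K_\lambda$ (for $\varphi_\lambda$) for every $\lambda\in(\lambda_0-\delta,\lambda_0+\delta)\cap J$. It is then called a continuation of $K_{\lambda_0}$ for each $\lambda_0\in J$. *)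

(* Defs.v *)
From mathcomp Require Import all_boot all_order all_algebra.
From mathcomp Require Import all_classical all_reals all_analysis.
Set Implicit Arguments.
Unset Strict Implicit.
Unset Printing Implicit Defensive.
Import Order.TTheory GRing.Theory Num.Theory.
Import numFieldNormedType.Exports.
Local Open Scope classical_set_scope.
Local Open Scope ring_scope.

Section flows.
Context {R : realType} {M : topologicalType}.
Implicit Types (phi : M * R -> M) (x : M) (I : set R) (A K N U V : set M).

Definition is_flow phi :=
  [/\ continuous phi,
      forall x, phi (x, 0) = x
    & forall x s t, phi (phi (x, s), t) = phi (x, s + t)].

(* written A I in the literature; x I is the case A = [set x] *)
Definition traj phi A I : set M := phi @` (A `*` I).

Definition omega_lim phi x : set M :=
  \bigcap_(t in [set t : R | 0 < t]) closure (traj phi [set x] `[t, +oo[%classic).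

Definition Omega_lim phi : set M := \bigcup_(x in [set: M]) omega_lim phi x.

Definition dissipative phi :=
  (forall x, omega_lim phi x !=set0) /\ compact (closure (Omega_lim phi)).

Definition invariant_set phi K := traj phi K [set: R] = K.

Definition stable phi K :=
  forall U, set_nbhs K U ->
    exists V, [/\ set_nbhs K V, V `<=` U & traj phi V `[0, +oo[%classic `<=` U].

Definition attraction_region phi K : set M :=
  [set x | omega_lim phi x !=set0 /\ omega_lim phi x `<=` K].

Definition attracting phi K :=
  exists2 U, set_nbhs K U & U `<=` attraction_region phi K.

Definition attractor phi K :=
  [/\ compact K, invariant_set phi K, attracting phi K & stable phi K].

Definition global_attractor phi K :=
  attractor phi K /\ attraction_region phi K = [set: M].

Definition maximal_invariant_in phi N K :=
  [/\ invariant_set phi K, K `<=` N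
    & forall S : set M, invariant_set phi S -> S `<=` N -> S `<=` K].

Definition isolating_nbhd phi K N :=
  [/\ compact N, set_nbhs K N & maximal_invariant_in phi N K].

Definition isolated_invariant_set phi K :=
  [/\ compact K, invariant_set phi K & exists N, isolating_nbhd phi K N].

End flows.

(* A family is indexed by all of R, but only its members with index in
   [0, 1] (resp. in the parameter interval J) are ever constrained or used. *)
Section families.
Context {R : realType} {M : topologicalType}.
Implicit Types (phi : R -> M * R -> M) (K : R -> set M) (J : set R).

Definition continuous_family phi :=
  {within [set: M * R] `*` `[0, 1]%classic,
    continuous (fun p : (M * R) * R => phi p.2 p.1)}.

Definition uniformly_dissipative phi :=
  (forall x (l : R), `[0, 1]%classic l -> omega_lim (phi l) x !=set0) /\
  compact (closure (\bigcup_(l in `[0, 1]%classic) Omega_lim (phi l))).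

Definition parameter_interval J :=
  exists a b : R, [/\ 0 <= a, a < b, b <= 1 & J = `[a, b]%classic].

Definition continuation phi J K :=
  [/\ parameter_interval J,
      forall l, J l -> isolated_invariant_set (phi l) (K l)
    & forall l0, J l0 -> forall N, isolating_nbhd (phi l0) (K l0) N ->
        exists2 d : R, 0 < d &
          forall l : R, (`]l0 - d, l0 + d[%classic `&` J) l ->
            isolating_nbhd (phi l) (K l) N].

(* (K_l)_(l in J) is a continuation of its member K_l0 *)
Definition continuation_of phi J K (l0 : R) := J l0 /\ continuation phi J K.

End families.

(* Main.v *)
Require Import Defs.
From mathcomp Require Import all_boot all_order all_algebra.
From mathcomp Require Import all_classical all_reals all_analysis.
From mathcomp Require Import lra.
Import Order.TTheory GRing.Theory Num.Theory.
Import numFieldNormedType.Exports.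
Local Open Scope classical_set_scope.
Local Open Scope ring_scope.

(** Since the global attractor K of a flow attracts every compact set
    uniformly ([stable_attracts_compact]), an invariant set lying in a compact
    set lies in every neighborhood of K, hence in K.  So every compact
    neighborhood of K isolates it ([global_attractor_isolating_nbhd]), and
    being a continuation amounts to upper semicontinuity of the family of
    attractors: a compact neighborhood of K_l0 is still a neighborhood of K_l
    for l close to l0.

    If the attractors form a continuation, each parameter has a compact set
    containing all attractors with nearby parameters; by compactness of [0, 1]
    a single compact set contains all of them, and with them all omega-limits.

    Conversely, let the compact set C be the closure of the union of the
    omega-limits of the whole family, and let N be a compact neighborhood of
    K_l0.  The attractor K_l need not lie in C, as it also contains orbits
    connecting omega-limits, so C alone does not bound it.  Instead take a
    compact neighborhood P of the union of C and N.  The flow of l0 sends P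
    into the interior of N from some time T > 0 on.  On the compact time span
    [T, 2T] this persists for l near l0 by continuity of the family, and it
    then persists for all times after T, because a point of N is again a point
    of P ([trapped_forever]).  Every point has an omega-limit point in C, hence
    visits the interior of P and ends up in the interior of N; the compact set
    K_l does so at a common time, and being invariant it lies in the interior
    of N ([near_global_attractor_subset]). *)

(** * Compactness *)

(** Passage from local to global bounds: finite unions of compact sets are
    compact, so compact bounds valid near each point of a compact set can be
    merged into one. *)
Lemma compact_upward_closed_bound {X Y : topologicalType} (A : set X)
    (Q : X -> set Y -> Prop) :
  compact A -> (forall x C D, C `<=` D -> Q x C -> Q x D) ->
  (forall x, A x ->
    exists2 C, compact C & \forall x' \near x, A x' -> Q x' C) ->
  exists2 C, compact C & forall x, A x -> Q x C.
Proof.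
move=> cA Qup Qloc.
(* F-near means: for every set that contains a suitable compact set. *)
pose F : set_system (set Y) := filter_from compact (fun C => [set D | C `<=` D]).
have FF : Filter F.
  apply: filter_from_filter; first by exists set0; exact: compact0.
  move=> C D cC cD; exists (C `|` D); first exact: compactU.
  by move=> E /= CDE; split; apply: subset_trans CDE => y; [left|right].
have [C cC AQ] : \near F, A `<=` (fun x => Q x F).
  move/compact_near_coveringP/near_covering_withinP: cA.
  move/(_ _ _ (fun C x => Q x C) FF); apply => x /Qloc [C cC nQ].
  exists ([set x' | A x' -> Q x' C], [set D | C `<=` D]).
    by split=> //; exists C.
  by move=> [x' D] /= [QC CD] Ax'; apply: Qup CD _; exact: QC.
by exists C => // x; apply: AQ.
Qed.

Lemma compact_neighborhood {M : topologicalType} (A : set M) :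
  locally_compact [set: M] -> compact A ->
  exists2 P, compact P & set_nbhs A P.
Proof.
move=> lcM cA.
apply: (compact_upward_closed_bound A (fun x P => nbhs x P) cA).
  by move=> x C D CD; exact: filterS.
move=> x _; have := lcM x I; rewrite withinET => -[C xC [cC _]].
exists C => //; near=> x' => _.
by near: x'; exact: nbhs_interior.
Unshelve. all: by end_near. Qed.

(** * Attraction of compact sets by one flow *)

Section single_flow.
Context {R : realType} {M : topologicalType}.
Implicit Types (phi : M * R -> M) (x y : M) (A K N P S U W : set M).

Lemma flow_continuous_at_time phi (t : R) :
  is_flow phi -> continuous (fun x => phi (x, t)).
Proof.
move=> [phic _ _] x.
apply: (@continuous_comp _ _ _ (fun x => (x, t)) phi); last exact: phic.
by apply: (@cvg_pair M M R (nbhs x) (nbhs x) (nbhs t)); [exact: cvg_id|exact: cvg_cst].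
Qed.

Lemma omega_lim_visit phi x y W :
  omega_lim phi x y -> open W -> W y -> exists t, W (phi (x, t)).
Proof.
move=> xy oW Wy; have [|z []] := xy 1 ltr01 W; first by apply: open_nbhs_nbhs; split.
by move=> [[_ t] [/= -> _] <-] Wz; exists t.
Qed.

(** Visiting the open set W at a given time is an open condition, so the
    arrival time in U is bounded near each point of A, and compactness makes
    it uniform over A. *)
Lemma compact_eventually_in phi A W U (T : R) :
  is_flow phi -> compact A -> open W ->
  (forall x t, W x -> T <= t -> U (phi (x, t))) ->
  (forall x, A x -> exists t, W (phi (x, t))) ->
  exists2 T' : R, 0 < T' & forall x t, A x -> T' <= t -> U (phi (x, t)).
Proof.
move=> flow cA oW WU AW.
have : \forall s \near +oo, A `<=` [set x | forall t, s <= t -> U (phi (x, t))].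
  move/compact_near_coveringP: cA.
  move/(_ _ (pinfty_nbhs R)
    (fun s x => forall t, s <= t -> U (phi (x, t))) _); apply => x /AW [t0 Wxt0].
  have nW : \forall x' \near x, W (phi (x', t0)).
    apply: (flow_continuous_at_time phi t0 flow x).
    by apply: open_nbhs_nbhs; split.
  exists ([set x' | W (phi (x', t0))], [set s | t0 + T <= s]).
    by split=> //=; apply: nbhs_pinfty_ge; rewrite num_real.
  move=> [x' s] /= [Wx' sT] t st.
  have [_ _ phiD] := flow.
  rewrite -(subrK t0 t) addrC -phiD; apply: WU => //.
  by lra.
move=> ns; near (pinfty_nbhs R) => s.
exists s => [|x t Ax]; first by near: s; exact: nbhs_pinfty_gt.
by apply: (near ns s _ x Ax).
Unshelve. all: by end_near. Qed.

(** Each point of an invariant set is the time-T image of another of its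
    points, so whatever holds of the whole set after time T holds of it now. *)
Lemma invariant_subset_image phi S A U (T : R) :
  is_flow phi -> invariant_set phi S -> S `<=` A ->
  (forall x, A x -> U (phi (x, T))) -> S `<=` U.
Proof.
move=> [_ _ phiD] invS SA AU x; rewrite -{1}invS => -[[y s] [/= Sy _] <-].
rewrite -(subrK T s) -phiD; apply/AU/SA.
by rewrite -invS; exists (y, s - T).
Qed.

(** Stability turns pointwise attraction into uniform attraction: a visit to
    a neighborhood of K whose orbits stay in U decides the whole future. *)
Lemma stable_attracts_compact phi K A U :
  is_flow phi -> stable phi K -> set_nbhs K U -> compact A ->
  A `<=` attraction_region phi K ->
  exists2 T : R, 0 < T & forall x t, A x -> T <= t -> U (phi (x, t)).
Proof.
move=> flow stK KU cA AK; have [V [KV _ VU]] := stK _ KU.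
have [W [oW KW WV]] := (set_nbhsP _ _).1 KV.
apply: (compact_eventually_in phi A W U 0) => //.
  move=> x t Wx t0; apply: VU; exists (x, t) => //; split; first exact: WV.
  by rewrite /= in_itv /= t0.
by move=> x /AK [[y xy] /(_ _ xy)/KW Wy]; exact: (omega_lim_visit phi x y).
Qed.

(** If an invariant subset of N had a point x outside K, then the complement
    of x would be a neighborhood of K into which N is eventually carried; by
    invariance the subset, x included, would lie in it. *)
Lemma global_attractor_isolating_nbhd phi K N :
  hausdorff_space M -> is_flow phi -> global_attractor phi K ->
  compact N -> set_nbhs K N -> isolating_nbhd phi K N.
Proof.
move=> hM flow [[cK invK _ stK] regK] cN KN; split => //; split => //.
  by move=> x /KN; exact: nbhs_singleton.
move=> S invS SN x Sx; apply: contrapT => nKx.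
have KxC : set_nbhs K (~` [set x]).
  apply/set_nbhsP; exists (~` [set x]); split => //; last first.
    by move=> y Ky yx; apply: nKx; rewrite -yx.
  by apply: closed_openC; apply: compact_closed => //; exact: compact_set1.
have [|T _ NT] := stable_attracts_compact phi K N _ flow stK KxC cN.
  by rewrite regK.
by have /(_ _ Sx) := invariant_subset_image phi S N _ T flow invS SN
  (fun y Ny => NT y T Ny (lexx T)); exact.
Qed.

(** What is known on the time span [T, 2T] can be restarted every T units of
    time, because the image of P lies in P again. *)
Lemma trapped_forever phi P U (T : R) :
  is_flow phi -> 0 < T -> U `<=` P ->
  (forall x t, P x -> T <= t <= T + T -> U (phi (x, t))) ->
  forall x t, P x -> T <= t -> U (phi (x, t)).
Proof.
move=> [_ _ phiD] T0 UP PU.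
have PUn n : forall x t, P x -> T <= t <= T + T *+ n.+1 -> U (phi (x, t)).
  elim: n => [|n IHn] x t Px /andP[Tt tT]; first by apply: PU; rewrite // Tt.
  have [t2|t2] := leP t (T + T); first by apply: PU; rewrite // Tt.
  rewrite -(subrK T t) -phiD; apply: PU; last by rewrite lexx /=; lra.
  apply/UP/IHn => //; rewrite lerBrDr ltW//= lerBlDr.
  by rewrite -addrA -mulrSr.
move=> x t Px Tt; apply: (PUn (Num.truncn (t / T))) => //; rewrite Tt /=.
have : t / T < (Num.truncn (t / T)).+1%:R by rewrite truncnS_gt.
by rewrite ltr_pdivrMr// mulr_natl => tn; rewrite (le_trans (ltW tn))// lerDr ltW.
Qed.

End single_flow.

(** * Families of flows *)

Section families_of_flows.
Context {R : realType} {M : topologicalType}.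
Implicit Type phi : R -> M * R -> M.

Lemma near_family_image_subset phi (A : set (M * R)) (U : set M) (l0 : R) :
  continuous_family phi -> `[0, 1]%classic l0 -> compact A -> open U ->
  (forall p, A p -> U (phi l0 p)) ->
  \forall l \near within `[0, 1]%classic (nbhs l0),
    forall p, A p -> U (phi l p).
Proof.
move=> /subspace_continuousP phic Jl0 cA oU AU.
move/compact_near_coveringP: cA.
move/(_ _ (within `[0, 1]%classic (nbhs l0)) (fun l p => U (phi l p)) _).
apply => p /AU Up.
have nU : nbhs (phi l0 p) U by apply: open_nbhs_nbhs; split.
have [[B C] /= [pB lC] BCU] := phic (p, l0) (conj I Jl0) U nU.
exists (B, `[0, 1]%classic `&` C).
  by split => //=; apply: filterS lC => l Cl Jl; split.
by move=> [q l] /= [Bq [Jl Cl]]; exact: (BCU (q, l) (conj Bq Cl) (conj I Jl)).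
Qed.

(** Upper semicontinuity of the global attractor, for families whose
    omega-limits all meet one compact set C.  That uniformity keeps K_l from
    reaching far away from K_l0 while the flow near K_l0 hardly changes. *)
Lemma near_global_attractor_subset phi (K : R -> set M) (N C : set M) (l0 : R) :
  locally_compact [set: M] ->
  (forall l : R, `[0, 1]%classic l -> is_flow (phi l)) ->
  continuous_family phi ->
  (forall l : R, `[0, 1]%classic l -> global_attractor (phi l) (K l)) ->
  compact C ->
  (forall (l : R) x, `[0, 1]%classic l -> omega_lim (phi l) x `&` C !=set0) ->
  `[0, 1]%classic l0 -> compact N -> set_nbhs (K l0) N ->
  \forall l \near within `[0, 1]%classic (nbhs l0), set_nbhs (K l) N.
Proof.
move=> lcM flow phic Kglob cC omC Jl0 cN KN.
have [U [oU KU UN]] := (set_nbhsP _ _).1 KN.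
have [P cP CNP] := compact_neighborhood (C `|` N) lcM (compactU cC cN).
have UP : U `<=` P by move=> x /UN Nx; apply: nbhs_singleton (CNP x (or_intror Nx)).
have [[_ _ _ stK0] regK0] := Kglob _ Jl0.
have [||T T0 PT] := stable_attracts_compact _ _ P U (flow _ Jl0) stK0 _ cP.
- by apply/set_nbhsP; exists U; split.
- by rewrite regK0.
have cPT : compact (P `*` `[T, T + T]%classic).
  by apply: compact_setX => //; exact: segment_compact.
have nPTU : \forall l \near within `[0, 1]%classic (nbhs l0),
    forall p, (P `*` `[T, T + T]%classic) p -> U (phi l p).
  apply: near_family_image_subset => //.
  by move=> [x t] [/= Px]; rewrite in_itv /= => /andP[Tt _]; exact: PT.
near=> l; have Jl : `[0, 1]%classic l by near: l; exact: withinT.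
have PTl x t : P x -> T <= t <= T + T -> U (phi l (x, t)).
  by move=> Px Tt; apply: (near nPTU l _ (x, t)).
have PTl_forever := trapped_forever (phi l) P U T (flow _ Jl) T0 UP PTl.
have [[cK invK _ _] _] := Kglob _ Jl.
have [|||T' _ KT'] :=
    compact_eventually_in (phi l) (K l) P° U T (flow _ Jl) cK.
- exact: open_interior.
- by move=> x t /interior_subset Px; exact: PTl_forever.
- move=> x _; have [y [xy Cy]] := omC l x Jl.
  by apply: omega_lim_visit xy _ _; [exact: open_interior|apply: CNP; left].
apply/set_nbhsP; exists U; split => //.
apply: (invariant_subset_image (phi l) (K l) (K l) U T') => //; first exact: flow.
by move=> x Kx; exact: KT'.
Unshelve. all: by end_near. Qed.

End families_of_flows.

Theorem theorem9 (R : realType) (M : metricType R)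
  (M_noncompact : ~ compact [set: M])
  (M_locally_compact : locally_compact [set: M])
  (phi : R -> M * R -> M)
  (phi_flow : forall l : R, `[0, 1]%classic l -> is_flow (phi l))
  (phi_continuous : continuous_family phi)
  (phi_dissipative : forall l : R, `[0, 1]%classic l -> dissipative (phi l))
  (K : R -> set M)
  (K_global : forall l : R, `[0, 1]%classic l -> global_attractor (phi l) (K l)) :
  continuation_of phi `[0, 1]%classic K 0 <-> uniformly_dissipative phi.
Proof.
have hM : hausdorff_space M := @metric_hausdorff _ M.
split=> [[_ [_ Kiso Kcont]]|[om_neq0 cOm]].
  split=> [x l /phi_dissipative[]//|].
  have [C cC KC] : exists2 C, compact C &
      forall l : R, `[0, 1]%classic l -> K l `<=` C.
    apply: (compact_upward_closed_bound _ (fun l C => K l `<=` C)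
      (@segment_compact R 0 1)); first by move=> l C D CD KC; exact: subset_trans CD.
    move=> l0 Jl0; have [_ _ [N isoN]] := Kiso _ Jl0.
    have [d d0 Nd] := Kcont _ Jl0 N isoN.
    exists N; first by case: isoN.
    near=> l => Jl; have [|_ _ [_ //]] := Nd l.
    split => //; near: l; apply: near_in_itvoo.
    by rewrite in_itv /=; apply/andP; split; lra.
  apply: (subclosed_compact _ cC); first exact: closed_closure.
  have /closure_id -> : closed C by exact: compact_closed.
  apply: closureS => y [l Jl [x _ xy]]; apply: (KC _ Jl).
  have [_ regK] := K_global _ Jl.
  have [_ omK] : attraction_region (phi l) (K l) x by rewrite regK.
  exact: omK.
have Kisolating l N : `[0, 1]%classic l -> compact N -> set_nbhs (K l) N ->
    isolating_nbhd (phi l) (K l) N.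
  by move=> Jl; apply: global_attractor_isolating_nbhd;
    [|exact: phi_flow|exact: K_global].
split; first by rewrite /= in_itv /= lexx ler01.
split.
- by exists 0, 1; split.
- move=> l Jl; have [[cK invK _ _] _] := K_global _ Jl; split => //.
  have [N cN KN] := compact_neighborhood _ M_locally_compact cK.
  by exists N; exact: Kisolating.
move=> l0 Jl0 N [cN KN _].
have : \forall l \near within `[0, 1]%classic (nbhs l0), set_nbhs (K l) N.
  apply: (near_global_attractor_subset phi K N _ l0 M_locally_compact phi_flow
    phi_continuous K_global cOm _ Jl0 cN KN).
  move=> l x Jl; have [y xy] := om_neq0 x l Jl; exists y; split => //.
  by apply: subset_closure; exists l => //; exists x.
move=> /nbhs_ballP [d /= d0 dN]; exists d => // l [ld Jl].
apply: Kisolating => //; apply: dN => //.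
by rewrite ball_itv.
Unshelve. all: by end_near. Qed.
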